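(* The functor $\mathscr B:\mathbf{sbal}\to\mathbf{pbal}$ is left adjoint to the functor $\mathscr R:\mathbf{pbal}\to\mathbf{sbal}$, and the two yield an equivalence of $\mathbf{sbal}$ and $\mathbf{spbal}$.
   Context: **bal-algebras.** All rings are commutative with $1$ and ring homomorphisms are unital. An $\ell$-ring is a ring $A$ with a lattice order such that $a\le b$ implies $a+c\le b+c$, and $0\le a,b$ implies $0\le ab$. It is bounded if for each $a$ there is $n\in\mathbb N$ with $-n\cdot1\le a\le n\cdot1$, and archimedean if whenever $na\le b$ for all $n\in\mathbb N$, then $a\le0$. An $\ell$-algebra is an $\ell$-ring that is an $\mathbb R$-algebra with $ra\ge0$ whenever $0\le a\in A$ and $0\le r\in\mathbb R$. $\mathbf{bal}$ is the category of bounded archimedean $\ell$-algebras and unital $\ell$-algebra homomorphisms; $r\in\mathbb R$ is identified with $r\cdot1\in A$. $\mathbb R^+=[0,\infty)$. **Proximities.** A reflexive proximity on $A\in\mathbf{bal}$ is a binary relation $\prec$ such that: (P1) $a\prec b$ implies $a\le b$; (P2) $a\le b\prec c\le d$ implies $a\prec d$; (P3) $a\prec b,c$ implies $a\prec b\wedge c$; (P4) $a,b\prec c$ implies $a\vee b\prec c$; (RP5) $a\prec b$ implies there is $c$ with $a\prec c\prec c\prec b$; (P6) $a\prec b$ and $c\prec d$ imply $a+c\prec b+d$; (P7) if $0\le a,b,c,d$, $a\prec b$ and $c\prec d$, then $ac\prec bd$; (P8) $r\prec r$ for $r\in\mathbb R$; (P9) $a\prec b$ and $r\in\mathbb R^+$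 imply $ra\prec rb$. $\mathbf{pbal}$ is the category of pairs $(A,\prec)$ with $A\in\mathbf{bal}$ and $\prec$ a reflexive proximity on $A$, with morphisms the $\mathbf{bal}$-morphisms $\alpha$ such that $a\prec b$ implies $\alpha(a)\prec\alpha(b)$. **sbal-algebras.** An $\ell$-monoid is a commutative monoid $(S,+,0)$ with a lattice order such that $a\le b\iff a+c\le b+c$, $(a\vee b)+c=(a+c)\vee(b+c)$ and $(a\wedge b)+c=(a+c)\wedge(b+c)$. An $\ell$-monoid morphism is a lattice morphism preserving addition. Let $S^+=\{a\in S:a\ge0\}$. An $\ell$-monoid $S$ is an $\ell$-semialgebra if there is a commutative associative multiplication on $S^+$ with identity $1$; $a(b+c)=ab+ac$ for $a,b,c\in S^+$; $a\le b$ implies $ac\le bc$ for $a,b,c\in S^+$; and there is a unital $\ell$-monoid morphism $\rho:\mathbb R\to S$ preserving multiplication. We write $r$ for $\rho(r)$ and $a-r$ for $a+\rho(-r)$. $S$ is bounded if for each $a$ there is $r\in\mathbb R^+$ with $-r\le a\le r$, and archimedean if for all $a,b,c,d\in S$, $na+b\le nc+d$ for all $n\in\mathbb N$ implies $a\le c$. The $\mathbb R^+$-action is $ra=\rho(r)a$ for $a\in S^+$, and $ra=r(a+s)-rs$ for general $a$, where $s\in\mathbb R^+$ is any element with $a+s\ge0$. $\mathbf{sbal}$ is the category of bounded archimedean $\ell$-semialgebras, with morphisms the unital $\ell$-monoid morphisms preserving multiplication on positive cones and the $\mathbb R^+$-action. **Functors.** $\mathscr R(A,\prec)=\{c\in A:c\prec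 c\}$, and $\mathscr R\alpha$ is the restriction of $\alpha$. For $S\in\mathbf{sbal}$, the $\mathbf{bal}$-envelope $\mathscr BS$ is the quotient of $S\times S$ by $(a,b)\sim(c,d)\iff a+d=b+c$, with classes $[a,b]$ (each representable with $a,b\ge0$), $[a,b]+[c,d]=[a+c,b+d]$, $[a,b][c,d]=[ac+bd,ad+bc]$ for $a,b,c,d\ge0$, $r[a,b]=[ra,rb]$ and $-r[a,b]=r[b,a]$ for $r\in\mathbb R^+$, and $[a,b]\le[c,d]\iff a+d\le b+c$. With $\varepsilon(a)=[a,0]$, the functor $\mathscr B:\mathbf{sbal}\to\mathbf{pbal}$ sends $S$ to $(\mathscr BS,\prec_S)$, where $x\prec_S y\iff\exists s\in S:\ x\le\varepsilon(s)\le y$, and sends $\alpha$ to $\mathscr B\alpha[a,b]=[\alpha(a),\alpha(b)]$. $\mathbf{spbal}$ is the full subcategory of $\mathbf{pbal}$ of the skeletal $(A,\prec)$, i.e. those with $A=\{c-d:c,d\in\mathscr R(A,\prec)\}$ (the latter set being the $\mathbf{bal}$-subalgebra generated by $\mathscr R(A,\prec)$, identified with $\mathscr B\mathscr R(A,\prec)$).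
   Formalization: Objects of sbal are also required to satisfy ad+bc ≤ ac+bd whenever a≤b and c≤d in the positive cone; this says exactly that products of positive elements of the envelope are positive, and without it the envelope need not be an ℓ-ring, so 𝓑 would not be defined. *)

(* Defs.v *)
From HB Require Import structures.
From mathcomp Require Import all_boot all_order all_algebra.
From mathcomp Require Import boolp reals.
From mathcomp Require Import ring.

Set Implicit Arguments.
Unset Strict Implicit.
Unset Printing Implicit Defensive.

Import Order.TTheory GRing.Theory Num.Theory.
Local Open Scope ring_scope.
Local Open Scope quotient_scope.

(* Combining [Order.Lattice] with a ring or monoid structure, or [GRing.Lmodule]
with a possibly zero ring, is rejected by Hierarchy Builder (a join missing below
[Num.RealDomain], resp. [GRing.LSemiAlgebra]).  Lattice orders and the action of
the reals on an algebra are therefore separate mixins here. *)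

HB.mixin Record hasLatticeOrder T := {
  lle : rel T;
  lmeet : T -> T -> T;
  ljoin : T -> T -> T;
  lle_refl : reflexive lle;
  lle_anti : forall x y, lle x y -> lle y x -> x = y;
  lle_trans : forall x y z, lle x y -> lle y z -> lle x z;
  lle_meet : forall x y z, lle x (lmeet y z) = lle x y && lle x z;
  ljoin_le : forall x y z, lle (ljoin x y) z = lle x z && lle y z
}.

#[short(type="latticeOrderedType")]
HB.structure Definition LatticeOrdered := {T of hasLatticeOrder T}.

Arguments lle_anti {s x y}.
Arguments lle_trans {s x y z}.

Notation "x ≼ y" := (lle x y) (at level 70, no associativity).
Notation "x ⊓ y" := (lmeet x y) (at level 48, left associativity).
Notation "x ⊔ y" := (ljoin x y) (at level 52, left associativity).

Section LatticeTheory.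
Variable T : latticeOrderedType.
Implicit Types x y z : T.

Lemma lleIl x y : x ⊓ y ≼ x.
Proof. by have := lle_meet (x ⊓ y) x y; rewrite lle_refl => /esym/andP[]. Qed.

Lemma lleIr x y : x ⊓ y ≼ y.
Proof. by have := lle_meet (x ⊓ y) x y; rewrite lle_refl => /esym/andP[]. Qed.

Lemma lleUl x y : x ≼ x ⊔ y.
Proof. by have := ljoin_le x y (x ⊔ y); rewrite lle_refl => /esym/andP[]. Qed.

Lemma lleUr x y : y ≼ x ⊔ y.
Proof. by have := ljoin_le x y (x ⊔ y); rewrite lle_refl => /esym/andP[]. Qed.

Lemma lle_meet_eq x y : x ≼ y <-> x ⊓ y = x.
Proof.
split=> [xy|<-]; last exact: lleIr.
by apply: lle_anti; rewrite ?lleIl // lle_meet lle_refl.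
Qed.

End LatticeTheory.

#[short(type="lnmodType")]
HB.structure Definition LNmodule := {V of GRing.Nmodule V & hasLatticeOrder V}.

(* [comPzRingType] rather than [comNzRingType]: the zero ring is allowed. *)
HB.mixin Record isLRing A of GRing.ComPzRing A & LNmodule A := {
  lring_leD2r : forall a b c : A, a ≼ b -> a + c ≼ b + c;
  lring_mul_ge0 : forall a b : A, 0 ≼ a -> 0 ≼ b -> 0 ≼ a * b
}.

#[short(type="lringType")]
HB.structure Definition LRing := {A of GRing.ComPzRing A & LNmodule A & isLRing A}.

HB.mixin Record isLAlgebra (R : realType) A of LRing A := {
  rscale : R -> A -> A;
  rscaleA : forall r s a, rscale r (rscale s a) = rscale (r * s) a;
  rscale1 : forall a, rscale 1 a = a;
  rscaleDr : forall r a b, rscale r (a + b) = rscale r a + rscale r b;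
  rscaleDl : forall r s a, rscale (r + s) a = rscale r a + rscale s a;
  rscaleAl : forall r a b, rscale r (a * b) = rscale r a * b;
  rscale_ge0 : forall r a, 0 <= r -> 0 ≼ a -> 0 ≼ rscale r a
}.

Section LRingTheory.
Variable A : lringType.
Implicit Types a b c d : A.

Lemma lring_leBr a b : (a ≼ b) = (0 ≼ b - a).
Proof.
apply/idP/idP => [/(lring_leD2r _ _ (- a))|/(lring_leD2r _ _ a)].
  by rewrite subrr.
by rewrite add0r subrK.
Qed.

Lemma lring_lerD2r c a b : (a + c ≼ b + c) = (a ≼ b).
Proof. by rewrite [LHS]lring_leBr opprD addrACA subrr addr0 -lring_leBr. Qed.

Lemma lring_leD a b c d : a ≼ b -> c ≼ d -> a + c ≼ b + d.
Proof.
move=> ab cd; apply: (@lle_trans _ _ (b + c)); first by rewrite lring_lerD2r.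
by rewrite ![b + _]addrC lring_lerD2r.
Qed.

Lemma lring_leM a b c d : 0 ≼ a -> 0 ≼ c -> a ≼ b -> c ≼ d -> a * c ≼ b * d.
Proof.
move=> a0 c0 ab cd; have b0 := lle_trans a0 ab.
apply: (@lle_trans _ _ (b * c)); rewrite lring_leBr.
  by rewrite -mulrBl lring_mul_ge0 // -lring_leBr.
by rewrite -mulrBr lring_mul_ge0 // -lring_leBr.
Qed.

Lemma lring_joinDl a b c : (a ⊔ b) + c = (a + c) ⊔ (b + c).
Proof.
apply: lle_anti; last by rewrite ljoin_le !lring_lerD2r lleUl lleUr.
rewrite -(lring_lerD2r (- c)) addrK ljoin_le.
by rewrite -!(lring_lerD2r c _ (_ - c)) subrK lleUl lleUr.
Qed.

Lemma lring_meetDl a b c : (a ⊓ b) + c = (a + c) ⊓ (b + c).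
Proof.
apply: lle_anti; first by rewrite lle_meet !lring_lerD2r lleIl lleIr.
rewrite -(lring_lerD2r (- c)) addrK lle_meet.
by rewrite -!(lring_lerD2r c (_ - c)) subrK lleIl lleIr.
Qed.

End LRingTheory.

#[short(type="lalgebraType")]
HB.structure Definition LAlgebra (R : realType) := {A of LRing A & isLAlgebra R A}.

Notation "r • a" := (rscale r a) (at level 40, left associativity).

Section LAlgebraTheory.
Variables (R : realType) (A : lalgebraType R).
Implicit Types (a b : A) (r : R).

Lemma rscale_mul1 r a : r • a = (r • 1) * a.
Proof. by rewrite -rscaleAl mul1r. Qed.

Lemma rscale_le r a b : 0 <= r -> a ≼ b -> r • a ≼ r • b.
Proof.
rewrite lring_leBr => r0 ab; rewrite lring_leBr (rscale_mul1 r a) (rscale_mul1 r b).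
by rewrite -mulrBr -rscale_mul1 rscale_ge0.
Qed.

Lemma rscaleB r a b : r • (a - b) = r • a - r • b.
Proof. by rewrite rscale_mul1 mulrBr -!rscale_mul1. Qed.

Lemma rscale0l a : (0 : R) • a = 0.
Proof. by apply: (@addrI _ ((0 : R) • a)); rewrite -rscaleDl !addr0. Qed.

Lemma rscaleNl r a : (- r) • a = - (r • a).
Proof. by apply/eqP; rewrite -addr_eq0 -rscaleDl addNr rscale0l. Qed.

Lemma rscale_nat (n : nat) : n%:R • 1 = n%:R :> A.
Proof.
by elim: n => [|n IH]; rewrite ?rscale0l // -natr1 rscaleDl IH rscale1 natr1.
Qed.

End LAlgebraTheory.

HB.mixin Record isBal (R : realType) A of LAlgebra R A := {
  bal_bounded : forall a : A, exists n : nat, - n%:R ≼ a /\ a ≼ n%:R;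
  bal_archimedean : forall a b : A, (forall n : nat, a *+ n ≼ b) -> a ≼ 0
}.

#[short(type="balType")]
HB.structure Definition Bal (R : realType) := {A of LAlgebra R A & isBal R A}.

Record is_bal_morphism (R : realType) (A B : balType R) (f : A -> B) : Prop := {
  bal_morphD : {morph f : a b / a + b};
  bal_morphM : {morph f : a b / a * b};
  bal_morph1 : f 1 = 1;
  bal_morphZ : forall r : R, {morph f : a / r • a};
  bal_morphI : {morph f : a b / a ⊓ b};
  bal_morphU : {morph f : a b / a ⊔ b}
}.

Record reflexive_proximity (R : realType) (A : balType R) (prox : A -> A -> Prop)
    : Prop := {
  prox_le : forall a b, prox a b -> a ≼ b;
  prox_trans : forall a b c d, a ≼ b -> prox b c -> c ≼ d -> prox a d;
  prox_meet : forall a b c, prox a b -> prox a c -> prox a (b ⊓ c);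
  prox_join : forall a b c, prox a c -> prox b c -> prox (a ⊔ b) c;
  prox_interp : forall a b, prox a b ->
    exists c, [/\ prox a c, prox c c & prox c b];
  prox_add : forall a b c d, prox a b -> prox c d -> prox (a + c) (b + d);
  prox_mul : forall a b c d, 0 ≼ a -> 0 ≼ b -> 0 ≼ c -> 0 ≼ d ->
    prox a b -> prox c d -> prox (a * c) (b * d);
  prox_real : forall r : R, prox (r • 1) (r • 1);
  prox_scale : forall a b (r : R), prox a b -> 0 <= r -> prox (r • a) (r • b)
}.

Record pbal_obj (R : realType) := PbalObj {
  pbal_car :> balType R;
  prox : pbal_car -> pbal_car -> Prop;
  proxP : reflexive_proximity prox
}.

Notation "a ≺ b" := (prox a b) (at level 70, no associativity).

Record pbal_hom (R : realType) (P Q : pbal_obj R) := PbalHom {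
  pbal_fun :> P -> Q;
  pbal_fun_bal : is_bal_morphism pbal_fun;
  pbal_fun_prox : forall a b, a ≺ b -> pbal_fun a ≺ pbal_fun b
}.

Definition skeletal (R : realType) (P : pbal_obj R) : Prop :=
  forall a : P, exists c d : P, [/\ c ≺ c, d ≺ d & a = c - d].

HB.mixin Record isLMonoid S of LNmodule S := {
  lmon_leD2r : forall a b c : S, (a ≼ b) = (a + c ≼ b + c);
  lmon_joinDl : forall a b c : S, (a ⊔ b) + c = (a + c) ⊔ (b + c);
  lmon_meetDl : forall a b c : S, (a ⊓ b) + c = (a + c) ⊓ (b + c)
}.

#[short(type="lmonoidType")]
HB.structure Definition LMonoid := {S of LNmodule S & isLMonoid S}.

Section PosCone.
Variable S : lmonoidType.
Implicit Types a b c : S.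

Lemma lmon_addIr c : injective (fun a => a + c).
Proof.
by move=> a b eq_ab; apply: lle_anti; rewrite (lmon_leD2r _ _ c) eq_ab lle_refl.
Qed.

Lemma lmon_leD a b c d : a ≼ b -> c ≼ d -> a + c ≼ b + d.
Proof.
rewrite (lmon_leD2r a _ c) (lmon_leD2r c _ b) => ab cd.
by apply: lle_trans ab _; rewrite ![b + _]addrC.
Qed.

Definition nonneg : pred S := [pred a | 0 ≼ a].

Fact nonneg_closed : Algebra.addumagma_closed nonneg.
Proof.
split; first by rewrite inE lle_refl.
by move=> a b; rewrite !inE => a0 b0; have := lmon_leD a0 b0; rewrite addr0.
Qed.

(* The positive cone S^+; it inherits the addition of S. *)
Definition posCone : Type := {a : S | nonneg a}.

HB.instance Definition _ := SubChoice.on posCone.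
HB.instance Definition _ :=
  GRing.SubChoice_isSubNmodule.Build S nonneg posCone nonneg_closed.

Lemma posCone_ge0 (p : posCone) : 0 ≼ val p.
Proof. exact: valP p. Qed.

Lemma val_coneD (p q : posCone) : val (p + q) = val p + val q.
Proof. by []. Qed.

Lemma val_cone0 : val (0 : posCone) = 0.
Proof. by []. Qed.

Lemma cone_addIr (r : posCone) : injective (fun p => p + r).
Proof. by move=> p q /(congr1 val); rewrite !val_coneD => /lmon_addIr/val_inj. Qed.

(* [a] itself when [0 ≼ a]; the value [0] elsewhere is never used. *)
Definition to_cone a : posCone := insubd 0 a.

Lemma to_coneK a : 0 ≼ a -> val (to_cone a) = a.
Proof. by move=> a0; rewrite val_insubd ifT. Qed.

Lemma to_cone_val p : to_cone (val p) = p.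
Proof. exact: valKd. Qed.

Lemma to_coneD a b : 0 ≼ a -> 0 ≼ b -> to_cone (a + b) = to_cone a + to_cone b.
Proof.
move=> a0 b0; apply: val_inj; rewrite val_coneD !to_coneK //.
by have := lmon_leD a0 b0; rewrite addr0.
Qed.

End PosCone.

Arguments posCone S : clear implicits.

HB.mixin Record isLSemialgebra (R : realType) S of LMonoid S := {
  cone_one : posCone S;
  cone_mul : posCone S -> posCone S -> posCone S;
  cone_mulC : commutative cone_mul;
  cone_mulA : associative cone_mul;
  cone_mul1 : left_id cone_one cone_mul;
  cone_mulDr : forall a b c, cone_mul a (b + c) = cone_mul a b + cone_mul a c;
  cone_mul_mono : forall a b c, val a ≼ val b ->
    val (cone_mul a c) ≼ val (cone_mul b c);
  rho : R -> S;
  rhoD : {morph rho : r s / r + s};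
  rho_min : forall r s, rho (Order.min r s) = rho r ⊓ rho s;
  rho_max : forall r s, rho (Order.max r s) = rho r ⊔ rho s;
  rho1 : rho 1 = val cone_one;
  rhoM : forall (r s : R) (a b : posCone S), 0 <= r -> 0 <= s ->
    val a = rho r -> val b = rho s -> val (cone_mul a b) = rho (r * s)
}.

#[short(type="lsemialgebraType")]
HB.structure Definition LSemialgebra (R : realType) :=
  {S of LMonoid S & isLSemialgebra R S}.

HB.mixin Record isSbal (R : realType) S of LSemialgebra R S := {
  sbal_bounded : forall a : S, exists r : R,
    [/\ 0 <= r, (rho (- r) : S) ≼ a & a ≼ rho r];
  sbal_archimedean : forall a b c d : S,
    (forall n : nat, a *+ n + b ≼ c *+ n + d) -> a ≼ c;
  (* An addition to the usual axioms, not implied by them: it says exactly that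
     products of nonnegative elements of the bal-envelope are nonnegative, without
     which the envelope is not an l-ring.  For instance the other axioms hold for
     S = {(x, y) : x <= y} in R^2 with pointwise order and sum, rho r = (r, r) and
     (x, y) * (u, v) = (x u, x v + y u - x u) on S^+.  With t = (0, 1), the element
     [1, t] of the envelope is nonnegative while [1, t]^2 = [1, 2 t] is not. *)
  sbal_cross : forall a b c d : posCone S, val a ≼ val b -> val c ≼ val d ->
    val (cone_mul a d + cone_mul b c) ≼ val (cone_mul a c + cone_mul b d)
}.

#[short(type="sbalType")]
HB.structure Definition Sbal (R : realType) := {S of LSemialgebra R S & isSbal R S}.

Section ConeRing.
Variables (R : realType) (S : lsemialgebraType R).

Fact cone_mulDl : left_distributive (@cone_mul R S) +%R.
Proof. by move=> a b c; rewrite !(cone_mulC _ c) cone_mulDr. Qed.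

Fact cone_mul0 : left_zero 0 (@cone_mul R S).
Proof.
move=> a; apply: (@cone_addIr S (cone_mul 0 a)).
by rewrite /= -cone_mulDl addr0 add0r.
Qed.

HB.instance Definition _ := GRing.Nmodule_isComPzSemiRing.Build (posCone S)
  (@cone_mulA R S) (@cone_mulC R S) (@cone_mul1 R S) cone_mulDl cone_mul0.

Lemma rho0 : rho 0 = 0 :> S.
Proof. by apply: (@lmon_addIr S (rho 0)); rewrite -rhoD addr0 add0r. Qed.

Lemma rhoN (r : R) : rho r + rho (- r) = 0 :> S.
Proof. by rewrite -rhoD subrr rho0. Qed.

Lemma rho_le (r s : R) : r <= s -> (rho r : S) ≼ rho s.
Proof.
move=> rs; have : (rho r : S) = rho r ⊓ rho s by rewrite -rho_min min_l.
have := lle_meet (rho r : S) (rho r) (rho s).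
by move=> + e; rewrite -{1}e !lle_refl /= => <-.
Qed.

Lemma rho_ge0 (r : R) : 0 <= r -> (0 : S) ≼ rho r.
Proof. by rewrite -rho0; exact: rho_le. Qed.

Definition rhoc (r : R) : posCone S := to_cone (rho r).

Lemma val_rhoc r : 0 <= r -> val (rhoc r) = rho r.
Proof. by move=> r0; rewrite to_coneK // rho_ge0. Qed.

Lemma rhoc1 : rhoc 1 = 1.
Proof. by apply: val_inj; rewrite val_rhoc // rho1. Qed.

Lemma rhoc0 : rhoc 0 = 0.
Proof. by apply: val_inj; rewrite val_rhoc // rho0. Qed.

Lemma rhocD r s : 0 <= r -> 0 <= s -> rhoc (r + s) = rhoc r + rhoc s.
Proof. by move=> r0 s0; rewrite /rhoc rhoD to_coneD ?rho_ge0. Qed.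

Lemma rhocM r s : 0 <= r -> 0 <= s -> rhoc (r * s) = rhoc r * rhoc s.
Proof.
move=> r0 s0; apply: val_inj; rewrite val_rhoc ?mulr_ge0 //.
by rewrite -(@rhoM _ _ r s (rhoc r) (rhoc s)) ?val_rhoc.
Qed.

End ConeRing.

Section Action.
Variables (R : realType) (S : sbalType R).
Implicit Types (r s : R) (a b : S).

Definition act_shift a : R := sval (cid (sbal_bounded a)).

Lemma shift_ge0 a : 0 <= act_shift a.
Proof. by rewrite /act_shift; case: cid => s []. Qed.

Lemma shiftP a : 0 ≼ a + rho (act_shift a).
Proof.
rewrite /act_shift; case: cid => s /= [s0 + _].
by rewrite (lmon_leD2r _ _ (rho s)) addrC rhoN.
Qed.

(* r a = r (a + s) - r s for one chosen s; meaningful for [0 <= r] only. *)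
Definition ract r a : S :=
  val (rhoc S r * to_cone (a + rho (act_shift a))) + rho (- (r * act_shift a)).

Lemma ractE r a s : 0 <= r -> 0 <= s -> 0 ≼ a + rho s ->
  ract r a = val (rhoc S r * to_cone (a + rho s)) + rho (- (r * s)).
Proof.
move=> r0 s0 as0; set t := act_shift a.
have t0 : 0 <= t := shift_ge0 a; have at0 : 0 ≼ a + rho t := shiftP a.
have H (u v : R) : 0 <= u -> 0 <= v -> 0 ≼ a + rho u ->
    val (rhoc S r * to_cone (a + rho u)) + rho (r * v) =
    val (rhoc S r * to_cone (a + rho u + rho v)).
  move=> u0 v0 au0; rewrite -(val_rhoc S (mulr_ge0 r0 v0)) rhocM //.
  by rewrite -val_coneD -mulrDr [to_cone (_ + rho v)]to_coneD //; exact: rho_ge0.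
have K (x v : S) u : x + rho (- u) + (rho u + v) = x + v.
  by rewrite -addrA (addrA (rho (- u))) [rho (- u) + _]addrC rhoN add0r.
apply: (@lmon_addIr S (rho (r * s) + rho (r * t))); rewrite /ract -/t K.
by rewrite [rho (r * s) + _]addrC K !H // addrAC.
Qed.

Lemma ract_cone r (p : posCone S) : 0 <= r -> ract r (val p) = val (rhoc S r * p).
Proof.
move=> r0; have p0 : 0 ≼ val p + rho (0 : R) by rewrite rho0 addr0 posCone_ge0.
by rewrite (ractE r0 _ p0) // mulr0 oppr0 rho0 !addr0 to_cone_val.
Qed.

Lemma ractD r a b : 0 <= r -> ract r (a + b) = ract r a + ract r b.
Proof.
move=> r0; set s := act_shift a; set t := act_shift b.
have as0 : 0 ≼ a + rho s := shiftP a; have bt0 : 0 ≼ b + rho t := shiftP b.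
have E : a + b + rho (s + t) = (a + rho s) + (b + rho t) by rewrite rhoD addrACA.
have st0 : 0 <= s + t by rewrite addr_ge0 ?shift_ge0.
have abst : 0 ≼ a + b + rho (s + t).
  by rewrite E; have := lmon_leD as0 bt0; rewrite addr0.
rewrite (ractE r0 st0 abst) E to_coneD // mulrDr val_coneD.
by rewrite mulrDr opprD rhoD addrACA.
Qed.

Lemma cone_shift a b : exists (s : R) (p q : posCone S),
  val p = a + rho s /\ val q = b + rho s.
Proof.
exists (act_shift a + act_shift b).
have pa : 0 ≼ a + rho (act_shift a + act_shift b).
  have := lmon_leD (shiftP a) (rho_ge0 S (shift_ge0 b)).
  by rewrite addr0 -addrA -rhoD.
have pb : 0 ≼ b + rho (act_shift a + act_shift b).
  have := lmon_leD (shiftP b) (rho_ge0 S (shift_ge0 a)).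
  by rewrite addr0 -addrA -rhoD [act_shift b + _]addrC.
by exists (to_cone (a + rho (act_shift a + act_shift b))), (to_cone (b + rho (act_shift a + act_shift b)));
  rewrite !to_coneK.
Qed.

End Action.

Record is_sbal_morphism (R : realType) (S T : sbalType R) (f : S -> T) : Prop := {
  sbal_morphD : {morph f : a b / a + b};
  sbal_morphI : {morph f : a b / a ⊓ b};
  sbal_morphU : {morph f : a b / a ⊔ b};
  sbal_morph1 : f (val (1 : posCone S)) = val (1 : posCone T);
  sbal_morphM : forall (a b : posCone S) (a' b' : posCone T),
    val a' = f (val a) -> val b' = f (val b) -> val (a' * b') = f (val (a * b));
  sbal_morphR : forall (r : R) a, 0 <= r -> f (ract r a) = ract r (f a)
}.

Record sbal_hom (R : realType) (S T : sbalType R) := SbalHom {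
  sbal_fun :> S -> T;
  sbal_fun_sbal : is_sbal_morphism sbal_fun
}.

Section Envelope.
Variables (R : realType) (S : sbalType R).
Implicit Types (a b c d : S) (p q : posCone S).

Definition env_rel : rel (S * S) := fun x y => x.1 + y.2 == x.2 + y.1.

Fact env_rel_refl : reflexive env_rel.
Proof. by move=> x; rewrite /env_rel addrC. Qed.

Fact env_rel_sym : symmetric env_rel.
Proof.
by move=> x y; rewrite /env_rel eq_sym [x.2 + _]addrC [x.1 + _]addrC.
Qed.

Fact env_rel_trans : transitive env_rel.
Proof.
move=> [c d] [a b] [e f]; rewrite /env_rel /= => /eqP ad /eqP cf; apply/eqP.
apply: (@lmon_addIr S (d + c)); rewrite /= (AC (2*2) ((1*3)*(4*2))%AC) /= ad cf.
by rewrite (AC (2*2) ((1*4)*(3*2))%AC).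
Qed.

Canonical env_equiv := EquivRel env_rel env_rel_refl env_rel_sym env_rel_trans.

Definition envelope : Type := {eq_quot env_equiv}.

HB.instance Definition _ := Choice.on envelope.

Definition cls a b : envelope := \pi_({eq_quot env_equiv}) (a, b).

Lemma clsP a b c d : cls a b = cls c d <-> a + d = b + c.
Proof.
rewrite /cls; split=> [/eqmodP/eqP //|e].
by apply/eqmodP/eqP.
Qed.

Definition env_num (x : envelope) : S := (repr (x : {eq_quot env_equiv})).1.
Definition env_den (x : envelope) : S := (repr (x : {eq_quot env_equiv})).2.

Lemma cls_env_num_den x : cls (env_num x) (env_den x) = x.
Proof. by rewrite /cls /env_num /env_den -surjective_pairing reprK. Qed.

Lemma env_num_den a b : env_num (cls a b) + b = env_den (cls a b) + a.
Proof. exact/clsP/cls_env_num_den. Qed.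

Definition pcls p q := cls (val p) (val q).

Lemma pclsP (p q p' q' : posCone S) : pcls p q = pcls p' q' <-> p + q' = q + p'.
Proof.
rewrite /pcls clsP -!val_coneD; split=> [/val_inj //|-> //].
Qed.

Lemma cls_cone x : exists pq : posCone S * posCone S, x = pcls pq.1 pq.2.
Proof.
have [s [p [q [Ep Eq]]]] := cone_shift (env_num x) (env_den x).
by exists (p, q); rewrite -[LHS]cls_env_num_den; apply/clsP; rewrite Ep Eq addrCA addrA.
Qed.

Definition cone_repr x : posCone S * posCone S := sval (cid (cls_cone x)).

Lemma cone_reprK x : x = pcls (cone_repr x).1 (cone_repr x).2.
Proof. exact: svalP (cid (cls_cone x)). Qed.

Definition env_zero := cls 0 0.
Definition env_one := cls (val (1 : posCone S)) 0.
Definition env_opp x := cls (env_den x) (env_num x).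
Definition env_add x y := cls (env_num x + env_num y) (env_den x + env_den y).
Definition env_mul x y :=
  let: (a, b) := cone_repr x in
  let: (c, d) := cone_repr y in
  pcls (a * c + b * d) (a * d + b * c).
Definition env_scale (r : R) x :=
  if 0 <= r then cls (ract r (env_num x)) (ract r (env_den x))
  else cls (ract (- r) (env_den x)) (ract (- r) (env_num x)).
Definition env_le x y := env_num x + env_den y ≼ env_den x + env_num y.
Definition env_meet x y :=
  cls ((env_num x + env_den y) ⊓ (env_den x + env_num y)) (env_den x + env_den y).
Definition env_join x y :=
  cls ((env_num x + env_den y) ⊔ (env_den x + env_num y)) (env_den x + env_den y).

Lemma env_addE a b c d : env_add (cls a b) (cls c d) = cls (a + c) (b + d).
Proof.
apply/clsP; rewrite addrACA (env_num_den a b) (env_num_den c d).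
by rewrite addrACA.
Qed.

Lemma env_oppE a b : env_opp (cls a b) = cls b a.
Proof. by apply/clsP; rewrite env_num_den. Qed.

Lemma env_leE a b c d : env_le (cls a b) (cls c d) = (a + d ≼ b + c).
Proof.
rewrite /env_le; have := env_num_den a b; have := env_num_den c d.
set x := cls a b; set y := cls c d => ey ex.
rewrite (lmon_leD2r (env_num x + env_den y) _ (b + d)) (lmon_leD2r (a + d) _ (env_den x + env_den y)).
congr (_ ≼ _).
  by rewrite addrACA ex (AC (2*2) ((2*4)*(1*3))%AC).
by rewrite addrACA ey (AC (2*2) ((2*4)*(1*3))%AC).
Qed.

Lemma env_meetE a b c d :
  env_meet (cls a b) (cls c d) = cls ((a + d) ⊓ (b + c)) (b + d).
Proof.
rewrite /env_meet; have := env_num_den a b; have := env_num_den c d.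
set x := cls a b; set y := cls c d => ey ex; apply/clsP.
rewrite [RHS]addrC !lmon_meetDl; congr (_ ⊓ _).
  by rewrite addrACA ex (AC (2*2) ((2*4)*(1*3))%AC).
by rewrite addrACA ey (AC (2*2) ((2*4)*(1*3))%AC).
Qed.

Lemma env_joinE a b c d :
  env_join (cls a b) (cls c d) = cls ((a + d) ⊔ (b + c)) (b + d).
Proof.
rewrite /env_join; have := env_num_den a b; have := env_num_den c d.
set x := cls a b; set y := cls c d => ey ex; apply/clsP.
rewrite [RHS]addrC !lmon_joinDl; congr (_ ⊔ _).
  by rewrite addrACA ex (AC (2*2) ((2*4)*(1*3))%AC).
by rewrite addrACA ey (AC (2*2) ((2*4)*(1*3))%AC).
Qed.

Lemma env_mulE (p q p' q' : posCone S) :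
  env_mul (pcls p q) (pcls p' q') = pcls (p * p' + q * q') (p * q' + q * p').
Proof.
rewrite /env_mul.
have := cone_reprK (pcls p q); case: (cone_repr (pcls p q)) => a b /pclsP /= e.
have := cone_reprK (pcls p' q'); case: (cone_repr (pcls p' q')) => c d /pclsP /= f.
apply/pclsP.
apply: (@cone_addIr S (p * c + q * d + p * d + q * c)) => /=.
have -> : a * c + b * d + (p * q' + q * p') + (p * c + q * d + p * d + q * c) =
  (q + a) * c + (p + b) * d + p * (q' + c) + q * (p' + d) by ring.
have -> : a * d + b * c + (p * p' + q * q') + (p * c + q * d + p * d + q * c) =
  (q + a) * d + (p + b) * c + p * (p' + d) + q * (q' + c) by ring.
by rewrite -e f; ring.
Qed.

Lemma env_scale_ge0E (r : R) p q : 0 <= r ->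
  env_scale r (pcls p q) = pcls (rhoc S r * p) (rhoc S r * q).
Proof.
move=> r0; rewrite /env_scale r0; apply/clsP.
by rewrite -!ract_cone // -!ractD // env_num_den.
Qed.

Lemma env_scaleE (r : R) a b : 0 <= r -> env_scale r (cls a b) = cls (ract r a) (ract r b).
Proof. by move=> r0; rewrite /env_scale r0; apply/clsP; rewrite -!ractD // env_num_den. Qed.

Lemma env_scaleN (r : R) a b : r < 0 ->
  env_scale r (cls a b) = cls (ract (- r) b) (ract (- r) a).
Proof.
move=> r0; rewrite /env_scale leNgt r0 /=; apply/clsP.
by rewrite -!ractD ?oppr_ge0 1?ltW // env_num_den.
Qed.

Lemma env_scale_lt0E (r : R) p q : r < 0 ->
  env_scale r (pcls p q) = pcls (rhoc S (- r) * q) (rhoc S (- r) * p).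
Proof. by move=> r0; rewrite env_scaleN // !ract_cone ?oppr_ge0 1?ltW. Qed.

Lemma clsW (P : envelope -> Prop) : (forall a b, P (cls a b)) -> forall x, P x.
Proof. by move=> H x; rewrite -(cls_env_num_den x). Qed.

Lemma pclsW (P : envelope -> Prop) : (forall p q, P (pcls p q)) -> forall x, P x.
Proof. by move=> H x; have [[p q] ->] := cls_cone x; exact: H. Qed.

Fact env_addA : associative env_add.
Proof.
by elim/clsW=> a b; elim/clsW=> c d; elim/clsW=> e f; rewrite !env_addE !addrA.
Qed.

Fact env_addC : commutative env_add.
Proof.
by elim/clsW=> a b; elim/clsW=> c d; rewrite !env_addE [a + _]addrC [b + _]addrC.
Qed.

Fact env_add0 : left_id env_zero env_add.
Proof. by elim/clsW=> a b; rewrite env_addE !add0r. Qed.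

Fact env_addN : left_inverse env_zero env_opp env_add.
Proof.
by elim/clsW=> a b; rewrite env_oppE env_addE; apply/clsP; rewrite !addr0 addrC.
Qed.

HB.instance Definition _ :=
  GRing.isZmodule.Build envelope env_addA env_addC env_add0 env_addN.

Fact env_mulA : associative env_mul.
Proof.
elim/pclsW=> a b; elim/pclsW=> c d; elim/pclsW=> e f; rewrite !env_mulE.
by apply/pclsP; ring.
Qed.

Fact env_mulC : commutative env_mul.
Proof.
by elim/pclsW=> a b; elim/pclsW=> c d; rewrite !env_mulE; apply/pclsP; ring.
Qed.

Fact env_mul1 : left_id env_one env_mul.
Proof.
elim/pclsW=> a b; rewrite -[env_one]/(pcls 1 0) env_mulE; apply/pclsP; ring.
Qed.

Lemma pclsD (p q p' q' : posCone S) : pcls p q + pcls p' q' = pcls (p + p') (q + q').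
Proof. exact: env_addE. Qed.

Fact env_mulDl : left_distributive env_mul +%R.
Proof.
elim/pclsW=> a b; elim/pclsW=> c d; elim/pclsW=> e f.
by rewrite !env_mulE !pclsD env_mulE; apply/pclsP; ring.
Qed.

HB.instance Definition _ :=
  GRing.Zmodule_isComPzRing.Build envelope env_mulA env_mulC env_mul1 env_mulDl.

Fact env_le_refl : reflexive env_le.
Proof. by move=> x; rewrite /env_le addrC lle_refl. Qed.

Fact env_le_anti x y : env_le x y -> env_le y x -> x = y.
Proof.
elim/clsW: x => a b; elim/clsW: y => c d; rewrite !env_leE => ad cb.
by apply/clsP/lle_anti => //; rewrite addrC [a + d]addrC.
Qed.

Fact env_le_trans x y z : env_le x y -> env_le y z -> env_le x z.
Proof.
elim/clsW: x => a b; elim/clsW: y => c d; elim/clsW: z => e f.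
rewrite !env_leE => ad cf; rewrite (lmon_leD2r _ _ (d + c)).
have := lmon_leD ad cf.
by rewrite (AC (2*2) ((1*4)*(2*3))%AC) [b + c + _](AC (2*2) ((1*4)*(3*2))%AC).
Qed.

Fact env_le_meet x y z : env_le x (env_meet y z) = env_le x y && env_le x z.
Proof.
elim/clsW: x => a b; elim/clsW: y => c d; elim/clsW: z => e f.
rewrite env_meetE !env_leE ![b + _]addrC lmon_meetDl lle_meet; congr (_ && _).
  rewrite (lmon_leD2r (a + d) _ f); congr (_ ≼ _); first by rewrite addrA.
  by rewrite addrAC.
rewrite (lmon_leD2r (a + f) _ d); congr (_ ≼ _).
  by rewrite addrA addrAC.
by rewrite -addrA [d + _]addrC.
Qed.

Fact env_join_le x y z : env_le (env_join x y) z = env_le x z && env_le y z.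
Proof.
elim/clsW: x => a b; elim/clsW: y => c d; elim/clsW: z => e f.
rewrite env_joinE !env_leE lmon_joinDl ljoin_le; congr (_ && _).
  by rewrite (lmon_leD2r (a + f) _ d) addrAC [b + d + e]addrAC.
by rewrite [b + c]addrC (lmon_leD2r (c + f) _ b) addrAC [b + d]addrC [d + b + e]addrAC.
Qed.

HB.instance Definition _ := hasLatticeOrder.Build envelope
  env_le_refl env_le_anti env_le_trans env_le_meet env_join_le.

Lemma cls_le a b c d : (cls a b ≼ cls c d) = (a + d ≼ b + c).
Proof. exact: env_leE. Qed.

Lemma cls_ge0 a b : (0 ≼ cls a b) = (b ≼ a).
Proof. by rewrite [LHS]env_leE !add0r. Qed.

Lemma clsD a b c d : cls a b + cls c d = cls (a + c) (b + d).
Proof. exact: env_addE. Qed.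

Lemma pclsM (p q p' q' : posCone S) :
  pcls p q * pcls p' q' = pcls (p * p' + q * q') (p * q' + q * p').
Proof. exact: env_mulE. Qed.

Fact env_leD2r (x y z : envelope) : x ≼ y -> x + z ≼ y + z.
Proof.
elim/clsW: x => a b; elim/clsW: y => c d; elim/clsW: z => e f.
rewrite !clsD !cls_le addrACA [b + f + _]addrACA [e + f]addrC.
by move=> H; apply: lmon_leD; rewrite ?lle_refl.
Qed.

Fact env_mul_ge0 (x y : envelope) : 0 ≼ x -> 0 ≼ y -> 0 ≼ x * y.
Proof.
elim/pclsW: x => a b; elim/pclsW: y => c d; rewrite pclsM !cls_ge0 => ba dc.
have := sbal_cross _ _ _ _ ba dc.
by rewrite [X in val X ≼ _]addrC [X in _ ≼ val X]addrC.
Qed.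

HB.instance Definition _ := isLRing.Build envelope env_leD2r env_mul_ge0.

Definition env_real (r : R) : envelope := cls (rho r) 0.

Lemma env_real_ge0 r : 0 <= r -> env_real r = pcls (rhoc S r) 0.
Proof. by move=> r0; rewrite /pcls val_rhoc. Qed.

Lemma env_realD r s : env_real (r + s) = env_real r + env_real s.
Proof. by rewrite /env_real clsD addr0 rhoD. Qed.

Lemma env_realN r : env_real (- r) = - env_real r.
Proof.
by apply/eqP; rewrite -addr_eq0 -env_realD addNr /env_real rho0.
Qed.

Lemma env_real1 : env_real 1 = 1.
Proof. by rewrite env_real_ge0 // rhoc1. Qed.

Lemma env_realM r s : env_real (r * s) = env_real r * env_real s.
Proof.
have H u v : 0 <= u -> 0 <= v -> env_real (u * v) = env_real u * env_real v.
  move=> u0 v0; rewrite !env_real_ge0 ?mulr_ge0 // rhocM // pclsM.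
  by rewrite !mulr0 !mul0r !addr0.
have H' u v : 0 <= u -> env_real (u * v) = env_real u * env_real v.
  move=> u0; case: (leP 0 v) => [/(H _ _ u0)//|/ltW v0].
  by rewrite -[v]opprK mulrN env_realN H ?oppr_ge0 // [env_real (- - v)]env_realN mulrN.
case: (leP 0 r) => [/H'//|/ltW r0].
by rewrite -[r]opprK mulNr env_realN H' ?oppr_ge0 // [env_real (- - r)]env_realN mulNr.
Qed.

Lemma env_scale_real r x : env_scale r x = env_real r * x.
Proof.
elim/pclsW: x => p q; case: (leP 0 r) => r0.
  rewrite env_scale_ge0E // env_real_ge0 // pclsM.
  by rewrite !mul0r !addr0.
rewrite env_scale_lt0E // -[r in env_real r]opprK env_realN env_real_ge0 ?oppr_ge0 1?ltW //.
by rewrite mulNr pclsM !mul0r !addr0; apply: esym; exact: env_oppE.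
Qed.

Fact env_scaleA r s x : env_scale r (env_scale s x) = env_scale (r * s) x.
Proof. by rewrite !env_scale_real env_realM mulrA. Qed.

Fact env_scale1 x : env_scale 1 x = x.
Proof. by rewrite env_scale_real env_real1 mul1r. Qed.

Fact env_scaleDr r (x y : envelope) : env_scale r (x + y) = env_scale r x + env_scale r y.
Proof. by rewrite !env_scale_real mulrDr. Qed.

Fact env_scaleDl r s (x : envelope) : env_scale (r + s) x = env_scale r x + env_scale s x.
Proof. by rewrite !env_scale_real env_realD mulrDl. Qed.

Fact env_scaleAl r (x y : envelope) : env_scale r (x * y) = env_scale r x * y.
Proof. by rewrite !env_scale_real mulrA. Qed.

Fact env_scale_pos r (x : envelope) : 0 <= r -> 0 ≼ x -> 0 ≼ env_scale r x.
Proof.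
move=> r0 x0; rewrite env_scale_real lring_mul_ge0 // /env_real cls_ge0.
exact: rho_ge0.
Qed.

HB.instance Definition _ := isLAlgebra.Build R envelope
  env_scaleA env_scale1 env_scaleDr env_scaleDl env_scaleAl env_scale_pos.

Lemma clsMn a b n : cls a b *+ n = cls (a *+ n) (b *+ n).
Proof.
elim: n => [|n IH]; first by rewrite !mulr0n.
by rewrite mulrS IH clsD -!mulrS.
Qed.

Lemma cls_real r : r • (1 : envelope) = cls (rho r) 0.
Proof. by rewrite [LHS]env_scale_real mulr1. Qed.

Fact env_bounded (x : envelope) : exists n : nat, - n%:R ≼ x /\ x ≼ n%:R.
Proof.
elim/clsW: x => a b.
have [r [r0 ra ar]] := sbal_bounded a; have [s [s0 sb bs]] := sbal_bounded b.
have rs0 : 0 <= r + s by rewrite addr_ge0.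
exists (Num.bound (r + s)); set n := Num.bound _.
have rsn : r + s <= n%:R by apply/ltW/archi_boundP.
rewrite -rscale_nat cls_real; split.
  rewrite -[- cls _ _]/(env_opp _) env_oppE cls_le add0r.
  apply: lle_trans bs _; rewrite (_ : s = (r + s) + (- r)); last by rewrite addrC addKr.
  by rewrite rhoD; apply: lmon_leD => //; exact: rho_le.
rewrite cls_le addr0; apply: lle_trans ar _.
rewrite (_ : r = - s + (r + s)); last by rewrite addrC addrK.
by rewrite rhoD; apply: lmon_leD => //; exact: rho_le.
Qed.

Fact env_archimedean (x y : envelope) : (forall n : nat, x *+ n ≼ y) -> x ≼ 0.
Proof.
elim/clsW: x => a b; elim/clsW: y => c d H.
rewrite [0]/(cls 0 0) cls_le !addr0; apply: (@sbal_archimedean _ _ a d b c) => n.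
by have := H n; rewrite clsMn cls_le.
Qed.

HB.instance Definition _ := isBal.Build R envelope env_bounded env_archimedean.

Definition env_emb (a : S) : envelope := cls a 0.

Lemma env_emb_le a b : (env_emb a ≼ env_emb b) = (a ≼ b).
Proof. by rewrite cls_le addr0 add0r. Qed.

Lemma env_embD a b : env_emb (a + b) = env_emb a + env_emb b.
Proof. by rewrite /env_emb clsD addr0. Qed.

Lemma env_embI a b : env_emb (a ⊓ b) = env_emb a ⊓ env_emb b.
Proof. by apply: esym; rewrite [LHS]env_meetE !addr0 !add0r. Qed.

Lemma env_embU a b : env_emb (a ⊔ b) = env_emb a ⊔ env_emb b.
Proof. by apply: esym; rewrite [LHS]env_joinE !addr0 !add0r. Qed.

Lemma env_embM p q : env_emb (val (p * q)) = env_emb (val p) * env_emb (val q).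
Proof.
by rewrite -[RHS]/(pcls p 0 * pcls q 0) pclsM !mulr0 !mul0r !addr0.
Qed.

Lemma env_embZ r a : 0 <= r -> env_emb (ract r a) = r • env_emb a.
Proof.
move=> r0; apply: esym; rewrite [LHS]env_scaleE // -[0]/(val (0 : posCone S)).
by rewrite ract_cone // mulr0.
Qed.

Definition env_prox (x y : envelope) : Prop :=
  exists s : S, x ≼ env_emb s /\ env_emb s ≼ y.

Fact env_proxP : reflexive_proximity env_prox.
Proof.
split.
- by move=> a b [s [/lle_trans as_ /as_]].
- move=> a b c d ab [s [bs sc]] cd; exists s; split; [exact: lle_trans bs|exact: lle_trans cd].
- move=> a b c [s [as_ sb]] [t [at_ tc]]; exists (s ⊓ t).
  rewrite env_embI !lle_meet as_ at_; split=> //; apply/andP.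
  by split; [apply: lle_trans sb; exact: lleIl|apply: lle_trans tc; exact: lleIr].
- move=> a b c [s [as_ sc]] [t [bt tc]]; exists (s ⊔ t).
  rewrite env_embU !ljoin_le sc tc; split=> //; apply/andP.
  by split; [apply: lle_trans as_ _; exact: lleUl|apply: lle_trans bt _; exact: lleUr].
- move=> a b [s [as_ sb]]; exists (env_emb s).
  by split; exists s; rewrite ?lle_refl.
- move=> a b c d [s [as_ sb]] [t [ct td]]; exists (s + t).
  by rewrite env_embD !lring_leD.
- move=> a b c d a0 b0 c0 d0 [s [as_ sb]] [t [ct td]].
  have := lle_trans c0 ct; have := lle_trans a0 as_; rewrite !cls_ge0 => s0 t0.
  exists (val (to_cone s * to_cone t)); rewrite env_embM !to_coneK //.
  by split; apply: lring_leM => //; rewrite cls_ge0.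
- by move=> r; exists (rho r); rewrite cls_real lle_refl.
- move=> a b r [s [as_ sb]] r0; exists (ract r s); rewrite env_embZ //.
  by split; exact: rscale_le.
Qed.

End Envelope.

Definition B_obj (R : realType) (S : sbalType R) : pbal_obj R :=
  PbalObj (@env_proxP R S).

Section EnvelopeMap.
Variables (R : realType) (S T : sbalType R) (f : sbal_hom S T).

Definition env_map (x : envelope S) : envelope T := cls (f (env_num x)) (f (env_den x)).

Lemma sbal_hom0 : f 0 = 0.
Proof.
apply: (@lmon_addIr T (f 0)).
by rewrite /= -(sbal_morphD (sbal_fun_sbal f)) addr0 add0r.
Qed.

Lemma sbal_hom_le a b : a ≼ b -> f a ≼ f b.
Proof.
by move=> /lle_meet_eq ab; apply/lle_meet_eq; rewrite -(sbal_morphI (sbal_fun_sbal f)) ab.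
Qed.

Definition cone_map (p : posCone S) : posCone T := to_cone (f (val p)).

Lemma val_cone_map p : val (cone_map p) = f (val p).
Proof. by rewrite to_coneK // -sbal_hom0 sbal_hom_le // posCone_ge0. Qed.

Lemma cone_mapD p q : cone_map (p + q) = cone_map p + cone_map q.
Proof.
by apply: val_inj; rewrite val_coneD !val_cone_map val_coneD (sbal_morphD (sbal_fun_sbal f)).
Qed.

Lemma cone_mapM p q : cone_map (p * q) = cone_map p * cone_map q.
Proof.
apply: val_inj; rewrite val_cone_map; apply: esym.
by apply: (sbal_morphM (sbal_fun_sbal f)); rewrite val_cone_map.
Qed.

Lemma env_mapE a b : env_map (cls a b) = cls (f a) (f b).
Proof.
by apply/clsP; rewrite -!(sbal_morphD (sbal_fun_sbal f)) env_num_den.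
Qed.

Lemma env_map_pcls p q : env_map (pcls p q) = pcls (cone_map p) (cone_map q).
Proof. by rewrite env_mapE /pcls !val_cone_map. Qed.

Fact env_map_bal : is_bal_morphism env_map.
Proof.
have fD := sbal_morphD (sbal_fun_sbal f).
split.
- by elim/clsW=> a b; elim/clsW=> c d; rewrite clsD !env_mapE clsD !fD.
- elim/pclsW=> a b; elim/pclsW=> c d.
  by rewrite pclsM !env_map_pcls pclsM !cone_mapD !cone_mapM.
- by rewrite [LHS]env_mapE sbal_hom0 (sbal_morph1 (sbal_fun_sbal f)).
- move=> r; elim/clsW=> a b; case: (leP 0 r) => r0.
    rewrite -[r • _ in LHS]/(env_scale r _) env_scaleE // !env_mapE.
    by rewrite !(sbal_morphR (sbal_fun_sbal f)) //; apply: esym; exact: env_scaleE.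
  rewrite -[r • _ in LHS]/(env_scale r _) env_scaleN // !env_mapE.
  rewrite !(sbal_morphR (sbal_fun_sbal f)) ?oppr_ge0 1?ltW //.
  by apply: esym; exact: env_scaleN.
- elim/clsW=> a b; elim/clsW=> c d; rewrite -[_ ⊓ _ in LHS]/(env_meet _ _) env_meetE.
  rewrite !env_mapE (sbal_morphI (sbal_fun_sbal f)) !fD; apply: esym; exact: env_meetE.
- elim/clsW=> a b; elim/clsW=> c d; rewrite -[_ ⊔ _ in LHS]/(env_join _ _) env_joinE.
  rewrite !env_mapE (sbal_morphU (sbal_fun_sbal f)) !fD; apply: esym; exact: env_joinE.
Qed.

Lemma bal_hom_le (A B : balType R) (g : A -> B) : is_bal_morphism g ->
  forall a b, a ≼ b -> g a ≼ g b.
Proof.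
by move=> gP a b /lle_meet_eq ab; apply/lle_meet_eq; rewrite -(bal_morphI gP) ab.
Qed.

Fact env_map_prox (x y : B_obj S) : x ≺ y -> (env_map x : B_obj T) ≺ env_map y.
Proof.
move=> [s [xs sy]]; exists (f s).
have <- : env_map (env_emb s) = env_emb (f s) by rewrite env_mapE sbal_hom0.
by split; apply: bal_hom_le => //; exact: env_map_bal.
Qed.

Definition B_map : pbal_hom (B_obj S) (B_obj T) :=
  @PbalHom R (B_obj S) (B_obj T) env_map env_map_bal env_map_prox.

End EnvelopeMap.

Section BalReals.
Variables (R : realType) (A : balType R).
Implicit Types r s : R.

(* In a general l-ring 1 need not be positive; boundedness is needed. *)
Fact bal_ge01 : (0 : A) ≼ 1.
Proof.
have [n [_ n1]] := @bal_bounded R A ((-1) ⊔ 0).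
case: n n1 => [|n] n1.
  by have := lle_trans (lleUl _ _) n1; rewrite lring_leBr opprK add0r.
have n0 : (0 : A) ≼ n.+1%:R := lle_trans (lleUr _ _) n1.
have inv0 : 0 <= n.+1%:R^-1 :> R by rewrite invr_ge0.
have := rscale_ge0 _ _ inv0 n0; rewrite -rscale_nat rscaleA mulVf ?pnatr_eq0 //.
by rewrite rscale1.
Qed.

Fact bal_real_le r s : r <= s -> r • (1 : A) ≼ s • 1.
Proof.
move=> rs; rewrite lring_leBr -rscaleNl -rscaleDl rscale_ge0 ?subr_ge0 //.
exact: bal_ge01.
Qed.

Fact bal_real_min r s : Order.min r s • (1 : A) = (r • 1) ⊓ (s • 1).
Proof.
by apply: esym; case: leP => [/bal_real_le/lle_meet_eq//|/ltW/bal_real_le sr];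
  apply: lle_anti; rewrite ?lleIr // lle_meet sr lle_refl.
Qed.

Fact bal_real_max r s : Order.max r s • (1 : A) = (r • 1) ⊔ (s • 1).
Proof.
by apply: esym; case: leP => [/bal_real_le sr|/ltW/bal_real_le sr];
  apply: lle_anti; rewrite ?lleUr ?lleUl // ljoin_le sr lle_refl.
Qed.

End BalReals.

Section Reflexives.
Variables (R : realType) (P : pbal_obj R).

Definition reflexive_elt : pred P := fun c => `[< c ≺ c >].

Definition reflexives : Type := {c : P | reflexive_elt c}.

HB.instance Definition _ := SubChoice.on reflexives.

Lemma reflexivesP (x : reflexives) : val x ≺ val x.
Proof. exact/asboolP/(valP x). Qed.

Definition mk_reflexive (c : P) (cc : c ≺ c) : reflexives := exist _ c (asboolT cc).

Lemma prox0 : (0 : P) ≺ 0.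
Proof. by rewrite -(rscale0l (1 : P)); exact: prox_real (proxP P) 0. Qed.

Lemma prox1 : (1 : P) ≺ 1.
Proof. by rewrite -(@rscale1 R P 1); exact: prox_real (proxP P) 1. Qed.

Fact reflexive_closed : Algebra.addumagma_closed reflexive_elt.
Proof.
split; first exact/asboolP/prox0.
move=> a b /asboolP aa /asboolP bb; apply/asboolP.
exact: prox_add (proxP P) _ _ _ _ aa bb.
Qed.

HB.instance Definition _ :=
  GRing.SubChoice_isSubNmodule.Build P reflexive_elt reflexives reflexive_closed.

Fact reflexives_meet (x y : reflexives) : (val x ⊓ val y) ≺ (val x ⊓ val y).
Proof.
have PP := proxP P; apply: (prox_meet PP).
  exact: prox_trans PP _ _ _ _ (lleIl _ _) (reflexivesP x) (lle_refl _).
exact: prox_trans PP _ _ _ _ (lleIr _ _) (reflexivesP y) (lle_refl _).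
Qed.

Fact reflexives_join (x y : reflexives) : (val x ⊔ val y) ≺ (val x ⊔ val y).
Proof.
have PP := proxP P; apply: (prox_join PP).
  exact: prox_trans PP _ _ _ _ (lle_refl _) (reflexivesP x) (lleUl _ _).
exact: prox_trans PP _ _ _ _ (lle_refl _) (reflexivesP y) (lleUr _ _).
Qed.

Definition reflexives_le : rel reflexives := fun x y => val x ≼ val y.

Fact reflexives_le_refl : reflexive reflexives_le.
Proof. by move=> x; exact: lle_refl. Qed.

Fact reflexives_le_anti x y : reflexives_le x y -> reflexives_le y x -> x = y.
Proof. by move=> xy yx; apply/val_inj/lle_anti. Qed.

Fact reflexives_le_trans x y z :
  reflexives_le x y -> reflexives_le y z -> reflexives_le x z.
Proof. exact: lle_trans. Qed.

HB.instance Definition _ := hasLatticeOrder.Build reflexives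
  reflexives_le_refl reflexives_le_anti reflexives_le_trans
  (fun x y z => lle_meet (val x) (val y) (val z)
    : reflexives_le x (mk_reflexive (reflexives_meet y z)) = _)
  (fun x y z => ljoin_le (val x) (val y) (val z)
    : reflexives_le (mk_reflexive (reflexives_join x y)) z = _).

Fact reflexives_leD2r (x y z : reflexives) : (x ≼ y) = (x + z ≼ y + z).
Proof. by apply: esym; exact: lring_lerD2r. Qed.

Fact reflexives_joinDl (x y z : reflexives) : (x ⊔ y) + z = (x + z) ⊔ (y + z).
Proof. by apply: val_inj; exact: lring_joinDl. Qed.

Fact reflexives_meetDl (x y z : reflexives) : (x ⊓ y) + z = (x + z) ⊓ (y + z).
Proof. by apply: val_inj; exact: lring_meetDl. Qed.

HB.instance Definition _ := isLMonoid.Build reflexives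
  reflexives_leD2r reflexives_joinDl reflexives_meetDl.

Definition rcone_val (p : posCone reflexives) : P := val (val p).

Lemma rcone_val_inj : injective rcone_val.
Proof. by move=> p q /val_inj/val_inj. Qed.

Lemma rcone_ge0 p : 0 ≼ rcone_val p.
Proof. exact: posCone_ge0 p. Qed.

Definition mk_rcone (c : P) (cc : c ≺ c) (c0 : 0 ≼ c) : posCone reflexives :=
  exist _ (mk_reflexive cc) (c0 : nonneg (mk_reflexive cc)).

Fact refl_cone_mul_subproof (p q : posCone reflexives) :
  rcone_val p * rcone_val q ≺ rcone_val p * rcone_val q.
Proof.
by apply: (prox_mul (proxP P)); rewrite ?rcone_ge0 //; exact: reflexivesP.
Qed.

Definition refl_cone_mul (p q : posCone reflexives) : posCone reflexives :=
  mk_rcone (refl_cone_mul_subproof p q)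
    (lring_mul_ge0 _ _ (rcone_ge0 p) (rcone_ge0 q)).

Definition refl_cone_one : posCone reflexives := mk_rcone prox1 (bal_ge01 P).

Definition refl_rho (r : R) : reflexives := mk_reflexive (prox_real (proxP P) r).

Fact refl_cone_mulC : commutative refl_cone_mul.
Proof. by move=> p q; apply: rcone_val_inj; exact: mulrC. Qed.

Fact refl_cone_mulA : associative refl_cone_mul.
Proof. by move=> p q r; apply: rcone_val_inj; exact: mulrA. Qed.

Fact refl_cone_mul1 : left_id refl_cone_one refl_cone_mul.
Proof. by move=> p; apply: rcone_val_inj; exact: mul1r. Qed.

Fact refl_cone_mulDr p q r :
  refl_cone_mul p (q + r) = refl_cone_mul p q + refl_cone_mul p r.
Proof. by apply: rcone_val_inj; exact: mulrDr. Qed.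

Fact refl_cone_mul_mono p q r : val p ≼ val q ->
  val (refl_cone_mul p r) ≼ val (refl_cone_mul q r).
Proof.
move=> pq; apply: (@lring_leM P (rcone_val p) (rcone_val q) (rcone_val r)) => //.
- exact: rcone_ge0.
- exact: rcone_ge0.
- exact: lle_refl.
Qed.

Fact refl_rhoD : {morph refl_rho : r s / r + s}.
Proof. by move=> r s; apply: val_inj; exact: rscaleDl. Qed.

Fact refl_rho_min r s : refl_rho (Order.min r s) = refl_rho r ⊓ refl_rho s.
Proof. by apply: val_inj; exact: bal_real_min. Qed.

Fact refl_rho_max r s : refl_rho (Order.max r s) = refl_rho r ⊔ refl_rho s.
Proof. by apply: val_inj; exact: bal_real_max. Qed.

Fact refl_rho1 : refl_rho 1 = val refl_cone_one.
Proof. by apply: val_inj; exact: rscale1. Qed.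

Fact refl_rhoM (r s : R) (a b : posCone reflexives) : 0 <= r -> 0 <= s ->
  val a = refl_rho r -> val b = refl_rho s ->
  val (refl_cone_mul a b) = refl_rho (r * s).
Proof.
move=> _ _ ar bs; apply: val_inj.
rewrite -[LHS]/(val (val a) * val (val b)) ar bs /=.
by rewrite -rscale_mul1 rscaleA.
Qed.

HB.instance Definition _ := isLSemialgebra.Build R reflexives
  refl_cone_mulC refl_cone_mulA refl_cone_mul1 refl_cone_mulDr refl_cone_mul_mono
  refl_rhoD refl_rho_min refl_rho_max refl_rho1 refl_rhoM.

Fact reflexives_bounded (a : reflexives) : exists r : R,
  [/\ 0 <= r, refl_rho (- r) ≼ a & a ≼ refl_rho r].
Proof.
have [n [na an]] := @bal_bounded R P (val a); exists n%:R; split; first exact: ler0n.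
  by rewrite -[_ ≼ _]/((- n%:R : R) • 1 ≼ val a) rscaleNl rscale_nat.
by rewrite -[_ ≼ _]/(val a ≼ (n%:R : R) • 1) rscale_nat.
Qed.

Lemma val_reflexivesMn (a : reflexives) n : val (a *+ n) = val a *+ n.
Proof. by elim: n => [//|n IH]; rewrite !mulrS -IH. Qed.

Fact reflexives_archimedean (a b c d : reflexives) :
  (forall n : nat, a *+ n + b ≼ c *+ n + d) -> a ≼ c.
Proof.
move=> H; rewrite -[_ ≼ _]/(val a ≼ val c) -(lring_lerD2r (- val c)) subrr.
apply: (@bal_archimedean R P _ (val d - val b)) => n.
have : val a *+ n + val b ≼ val c *+ n + val d.
  by rewrite -!val_reflexivesMn; exact: H.
rewrite mulrnBl lring_leBr [in X in _ -> X]lring_leBr.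
by congr (_ ≼ _); ring.
Qed.

Fact reflexives_cross (a b c d : posCone reflexives) : val a ≼ val b -> val c ≼ val d ->
  val (refl_cone_mul a d + refl_cone_mul b c) ≼
  val (refl_cone_mul a c + refl_cone_mul b d).
Proof.
move=> ab cd; set w := rcone_val.
rewrite -[_ ≼ _]/(w a * w d + w b * w c ≼ w a * w c + w b * w d) lring_leBr.
have -> : w a * w c + w b * w d - (w a * w d + w b * w c) = (w b - w a) * (w d - w c).
  by ring.
by rewrite lring_mul_ge0 // -lring_leBr.
Qed.

HB.instance Definition _ := isSbal.Build R reflexives
  reflexives_bounded reflexives_archimedean reflexives_cross.

Lemma val_reflexives_ract (r : R) (a : reflexives) : 0 <= r ->
  val (ract r a) = r • val a.
Proof.
move=> r0; rewrite /ract; set s := act_shift a.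
have as0 : 0 ≼ a + rho s := shiftP a.
rewrite -[LHS]/(rcone_val (rhoc _ r) * rcone_val (to_cone (a + rho s)) + (- (r * s)) • 1).
have -> : rcone_val (to_cone (a + rho s)) = val a + s • 1.
  by rewrite /rcone_val to_coneK.
have -> : rcone_val (rhoc reflexives r) = r • 1 by rewrite /rcone_val val_rhoc.
by rewrite -rscale_mul1 rscaleDr rscaleA rscaleNl addrK.
Qed.

End Reflexives.

Section ReflexivesMap.
Variables (R : realType) (P Q : pbal_obj R) (f : pbal_hom P Q).

Definition refl_map (x : reflexives P) : reflexives Q :=
  mk_reflexive (pbal_fun_prox f (reflexivesP x)).

Fact refl_map_sbal : is_sbal_morphism refl_map.
Proof.
have fP := pbal_fun_bal f; split.
- by move=> x y; apply: val_inj; exact: bal_morphD fP _ _.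
- by move=> x y; apply: val_inj; exact: bal_morphI fP _ _.
- by move=> x y; apply: val_inj; exact: bal_morphU fP _ _.
- by apply: val_inj; exact: bal_morph1 fP.
- move=> a b a' b' ea eb; apply: val_inj.
  rewrite -[LHS]/(val (val a') * val (val b')) ea eb.
  by apply: esym; exact: bal_morphM fP _ _.
- move=> r a r0; apply: val_inj.
  rewrite val_reflexives_ract // -[LHS]/(f (val (ract r a))) val_reflexives_ract //.
  exact: bal_morphZ fP _ _.
Qed.

Definition R_map : sbal_hom (reflexives P) (reflexives Q) := SbalHom refl_map_sbal.

End ReflexivesMap.

Record category := Category {
  cat_obj :> Type;
  cat_hom : cat_obj -> cat_obj -> Type;
  cat_id : forall a, cat_hom a a;
  cat_comp : forall a b c, cat_hom b c -> cat_hom a b -> cat_hom a c;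
  cat_idl : forall a b (f : cat_hom a b), cat_comp (cat_id b) f = f;
  cat_idr : forall a b (f : cat_hom a b), cat_comp f (cat_id a) = f;
  cat_compA : forall a b c d (h : cat_hom c d) (g : cat_hom b c) (f : cat_hom a b),
    cat_comp h (cat_comp g f) = cat_comp (cat_comp h g) f
}.

Arguments cat_id {_} _.
Arguments cat_comp {_ _ _ _} _ _.

Notation "g ∘ f" := (cat_comp g f) (at level 40, left associativity).

Record functor (C D : category) := Functor {
  fobj :> C -> D;
  fmap : forall a b : C, cat_hom a b -> cat_hom (fobj a) (fobj b);
  fmap_id : forall a : C, fmap (cat_id a) = cat_id (fobj a);
  fmap_comp : forall (a b c : C) (g : cat_hom b c) (f : cat_hom a b),
    fmap (g ∘ f) = fmap g ∘ fmap f
}.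

Arguments fmap {_ _} _ {_ _} _.

Definition functor_id (C : category) : functor C C :=
  @Functor C C id (fun _ _ f => f) (fun _ => erefl) (fun _ _ _ _ _ => erefl).

Section FunctorComp.
Variables (C D E : category) (G : functor D E) (F : functor C D).

Fact functor_comp_id (a : C) : fmap G (fmap F (cat_id a)) = cat_id (G (F a)).
Proof. by rewrite !fmap_id. Qed.

Fact functor_comp_comp (a b c : C) (g : cat_hom b c) (f : cat_hom a b) :
  fmap G (fmap F (g ∘ f)) = fmap G (fmap F g) ∘ fmap G (fmap F f).
Proof. by rewrite !fmap_comp. Qed.

Definition functor_comp : functor C E :=
  @Functor C E (fun a => G (F a)) (fun _ _ f => fmap G (fmap F f))
    functor_comp_id functor_comp_comp.

End FunctorComp.

Definition left_adjoint (C D : category) (F : functor C D) (G : functor D C) : Prop :=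
  exists phi : forall (c : C) (d : D), cat_hom (F c) d -> cat_hom c (G d),
    [/\ forall c d, bijective (phi c d),
        forall c d d' (g : cat_hom d d') (f : cat_hom (F c) d),
          phi c d' (g ∘ f) = fmap G g ∘ phi c d f &
        forall c c' d (h : cat_hom c' c) (f : cat_hom (F c) d),
          phi c' d (f ∘ fmap F h) = phi c d f ∘ h].

Definition is_iso (C : category) (a b : C) (f : cat_hom a b) : Prop :=
  exists g : cat_hom b a, g ∘ f = cat_id a /\ f ∘ g = cat_id b.

Definition naturally_isomorphic (C D : category) (F G : functor C D) : Prop :=
  exists eta : forall a : C, cat_hom (F a) (G a),
    (forall (a b : C) (f : cat_hom a b), fmap G f ∘ eta a = eta b ∘ fmap F f) /\
    (forall a, is_iso (eta a)).

Definition cat_equivalence (C D : category) (F : functor C D) (G : functor D C) : Prop :=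
  naturally_isomorphic (functor_id C) (functor_comp G F) /\
  naturally_isomorphic (functor_comp F G) (functor_id D).

Section FullSubcategory.
Variables (C : category) (P : C -> Prop).

Definition full_subcategory : category :=
  @Category {a : C | P a} (fun a b => cat_hom (sval a) (sval b)) (fun a => cat_id (sval a))
    (fun _ _ _ g f => g ∘ f) (fun _ _ f => cat_idl f) (fun _ _ f => cat_idr f)
    (fun _ _ _ _ h g f => cat_compA h g f).

Definition inclusion : functor full_subcategory C :=
  @Functor full_subcategory C (fun a => sval a) (fun _ _ f => f)
    (fun _ => erefl) (fun _ _ _ _ _ => erefl).

Definition corestrict (D : category) (F : functor D C) (FP : forall d, P (F d)) :
    functor D full_subcategory :=
  @Functor D full_subcategory (fun d => exist P (F d) (FP d)) (fun _ _ f => fmap F f)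
    (fmap_id F) (fun _ _ _ g f => fmap_comp F g f).

End FullSubcategory.

Lemma pbal_hom_eq (R : realType) (P Q : pbal_obj R) (f g : pbal_hom P Q) :
  f =1 g -> f = g.
Proof.
case: f g => [f f1 f2] [g g1 g2] /= /funext fg; subst g.
by congr PbalHom; exact: Prop_irrelevance.
Qed.

Lemma sbal_hom_eq (R : realType) (S T : sbalType R) (f g : sbal_hom S T) :
  f =1 g -> f = g.
Proof.
case: f g => [f f1] [g g1] /= /funext fg; subst g.
by congr SbalHom; exact: Prop_irrelevance.
Qed.

Section Pbal.
Variable R : realType.

Fact pbal_id_bal (P : pbal_obj R) : is_bal_morphism (id : P -> P).
Proof. by []. Qed.

Definition pbal_id (P : pbal_obj R) : pbal_hom P P :=
  @PbalHom R P P id (pbal_id_bal P) (fun _ _ h => h).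

Fact pbal_comp_bal (P Q T : pbal_obj R) (g : pbal_hom Q T) (f : pbal_hom P Q) :
  is_bal_morphism (g \o f).
Proof.
have [fD fM f1 fZ fI fU] := pbal_fun_bal f.
have [gD gM g1 gZ gI gU] := pbal_fun_bal g.
by split=> [a b|a b||r a|a b|a b] /=;
  rewrite ?fD ?fM ?f1 ?fZ ?fI ?fU ?gD ?gM ?g1 ?gZ ?gI ?gU.
Qed.

Definition pbal_comp (P Q T : pbal_obj R) (g : pbal_hom Q T) (f : pbal_hom P Q) :
    pbal_hom P T :=
  @PbalHom R P T (g \o f) (pbal_comp_bal g f)
    (fun _ _ h => pbal_fun_prox g (pbal_fun_prox f h)).

Fact pbal_comp_idl (P Q : pbal_obj R) (f : pbal_hom P Q) : pbal_comp (pbal_id Q) f = f.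
Proof. exact: pbal_hom_eq. Qed.

Fact pbal_comp_idr (P Q : pbal_obj R) (f : pbal_hom P Q) : pbal_comp f (pbal_id P) = f.
Proof. exact: pbal_hom_eq. Qed.

Fact pbal_compA (P Q T U : pbal_obj R)
    (h : pbal_hom T U) (g : pbal_hom Q T) (f : pbal_hom P Q) :
  pbal_comp h (pbal_comp g f) = pbal_comp (pbal_comp h g) f.
Proof. exact: pbal_hom_eq. Qed.

Definition pbal : category :=
  @Category (pbal_obj R) (@pbal_hom R) pbal_id pbal_comp
    pbal_comp_idl pbal_comp_idr pbal_compA.

Definition spbal : category := full_subcategory (@skeletal R : pbal -> Prop).

Definition spbal_inclusion : functor spbal pbal := inclusion (@skeletal R : pbal -> Prop).

Fact sbal_id_sbal (S : sbalType R) : is_sbal_morphism (id : S -> S).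
Proof. by split=> // a b a' b' /val_inj -> /val_inj ->. Qed.

Definition sbal_id (S : sbalType R) : sbal_hom S S := SbalHom (sbal_id_sbal S).

Fact sbal_comp_sbal (S T U : sbalType R) (g : sbal_hom T U) (f : sbal_hom S T) :
  is_sbal_morphism (g \o f).
Proof.
have [fD fI fU f1 fM fR] := sbal_fun_sbal f.
have [gD gI gU g1 gM gR] := sbal_fun_sbal g.
split=> [a b|a b|a b||a b a' b' ea eb|r a r0] /=.
- by rewrite fD gD.
- by rewrite fI gI.
- by rewrite fU gU.
- by rewrite f1 g1.
- have -> : f (val (a * b)) = val (cone_map f a * cone_map f b).
    by rewrite -cone_mapM val_cone_map.
  by apply: gM; rewrite val_cone_map.
- by rewrite fR // gR.
Qed.

Definition sbal_comp (S T U : sbalType R) (g : sbal_hom T U) (f : sbal_hom S T) :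
  sbal_hom S U := SbalHom (sbal_comp_sbal g f).

Fact sbal_comp_idl (P Q : sbalType R) (f : sbal_hom P Q) : sbal_comp (sbal_id Q) f = f.
Proof. exact: sbal_hom_eq. Qed.

Fact sbal_comp_idr (P Q : sbalType R) (f : sbal_hom P Q) : sbal_comp f (sbal_id P) = f.
Proof. exact: sbal_hom_eq. Qed.

Fact sbal_compA (P Q T U : sbalType R)
    (h : sbal_hom T U) (g : sbal_hom Q T) (f : sbal_hom P Q) :
  sbal_comp h (sbal_comp g f) = sbal_comp (sbal_comp h g) f.
Proof. exact: sbal_hom_eq. Qed.

Definition sbal : category :=
  @Category (sbalType R) (@sbal_hom R) sbal_id sbal_comp
    sbal_comp_idl sbal_comp_idr sbal_compA.

Fact B_map_id (S : sbalType R) : B_map (sbal_id S) = pbal_id (B_obj S).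
Proof. by apply: pbal_hom_eq => x; exact: cls_env_num_den. Qed.

Fact B_map_comp (S T U : sbalType R) (g : sbal_hom T U) (f : sbal_hom S T) :
  B_map (sbal_comp g f) = pbal_comp (B_map g) (B_map f).
Proof.
apply: pbal_hom_eq; elim/clsW=> a b.
by rewrite /= !env_mapE.
Qed.

Definition functor_B : functor sbal pbal :=
  @Functor sbal pbal (@B_obj R) (@B_map R) B_map_id B_map_comp.

Fact R_map_id (P : pbal_obj R) : R_map (pbal_id P) = sbal_id (reflexives P).
Proof. by apply: sbal_hom_eq => x; exact: val_inj. Qed.

Fact R_map_comp (P Q T : pbal_obj R) (g : pbal_hom Q T) (f : pbal_hom P Q) :
  R_map (pbal_comp g f) = sbal_comp (R_map g) (R_map f).
Proof. by apply: sbal_hom_eq => x; exact: val_inj. Qed.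

Definition functor_R : functor pbal sbal :=
  @Functor pbal sbal (fun P => reflexives P : sbalType R) (@R_map R) R_map_id R_map_comp.

End Pbal.

(* Main.v *)
Require Import Defs.
From mathcomp Require Import all_boot all_order all_algebra reals.
From mathcomp Require Import boolp ring.

(** The unit [S -> R B S] sends [s] to [[s, 0]] and the counit [B R P -> P] sends
[[a, b]] to [a - b].  The unit is always bijective: a reflexive [x] of [B S] satisfies
[x <= eps s <= x] for some [s].  The counit is always injective and reflects the
proximity, because (RP5) puts a reflexive element between any [a ≺ b]; it is
surjective exactly when [P] is skeletal. *)

Set Implicit Arguments.
Unset Strict Implicit.
Unset Printing Implicit Defensive.

Import Order.TTheory GRing.Theory Num.Theory.
Local Open Scope ring_scope.

Section Isomorphisms.
Variable R : realType.

(** All that a morphism preserves is given by operations, so the inverse map preserves it too: apply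
    [f] and cancel. *)
Lemma sbal_bij_iso (S T : sbal R) (f : sbal_hom S T) :
  bijective f -> is_iso (f : cat_hom S T).
Proof.
move=> [g fK gK]; have [fD fI fU f1 fM fR] := sbal_fun_sbal f.
have gP : is_sbal_morphism g.
  split.
  - by move=> x y; apply: (can_inj fK); rewrite fD !gK.
  - by move=> x y; apply: (can_inj fK); rewrite fI !gK.
  - by move=> x y; apply: (can_inj fK); rewrite fU !gK.
  - by rewrite -f1 fK.
  - move=> a b a' b' ea eb; apply: (can_inj fK); rewrite gK.
    (* [fM] is used with the roles exchanged: [a'], [b'] are the arguments and [a], [b] their images
       under [f]. *)
    by apply: esym; apply: fM; rewrite ?ea ?eb gK.
  - by move=> r a r0; apply: (can_inj fK); rewrite fR // !gK.
by exists (SbalHom gP); split; apply: sbal_hom_eq => x /=; rewrite ?fK ?gK.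
Qed.

(** The proximity is a relation, not an operation, so bijectivity does not carry it back; reflection
    is a separate hypothesis. *)
Lemma pbal_bij_iso (P Q : pbal R) (f : pbal_hom P Q) :
  bijective f -> (forall x y : pbal_car P, f x ≺ f y -> x ≺ y) ->
  is_iso (f : cat_hom P Q).
Proof.
move=> [g fK gK] f_refl; have [fD fM f1 fZ fI fU] := pbal_fun_bal f.
have gP : is_bal_morphism g.
  by split=> [x y|x y||r x|x y|x y]; apply: (can_inj fK);
    rewrite ?fD ?fM ?f1 ?fZ ?fI ?fU !gK.
have gprox (x y : pbal_car Q) : x ≺ y -> g x ≺ g y.
  by move=> xy; apply: f_refl; rewrite !gK.
by exists (PbalHom gP gprox); split; apply: pbal_hom_eq => x /=; rewrite ?fK ?gK.
Qed.

End Isomorphisms.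

Section Unit.
Variables (R : realType) (S : sbalType R).

Fact env_emb_prox (s : S) : (env_emb s : B_obj S) ≺ env_emb s.
Proof. by exists s; rewrite lle_refl. Qed.

Definition unit_fun (s : S) : reflexives (B_obj S) := mk_reflexive (env_emb_prox s).

Lemma env_emb_inj : injective (@env_emb R S).
Proof. by move=> a b /clsP; rewrite addr0 add0r. Qed.

Fact unit_sbal : is_sbal_morphism unit_fun.
Proof.
split.
- by move=> a b; apply: val_inj; exact: env_embD.
- by move=> a b; apply: val_inj; exact: env_embI.
- by move=> a b; apply: val_inj; exact: env_embU.
(* Under [val] both sides are the class [1, 0] by conversion. *)
- exact: val_inj.
- move=> a b a' b' ea eb; apply: val_inj.
  rewrite -[LHS]/(val (val a') * val (val b')) ea eb.
  by apply: esym; exact: env_embM.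
- move=> r a r0; apply: val_inj.
  by rewrite val_reflexives_ract // -[LHS]/(env_emb (ract r a)) env_embZ.
Qed.

Definition adj_unit : sbal_hom S (reflexives (B_obj S)) := SbalHom unit_sbal.

Lemma adj_unit_bij : bijective adj_unit.
Proof.
have emb_surj (x : reflexives (B_obj S)) : exists s, adj_unit s = x.
  have [s [xs sx]] := reflexivesP x.
  by exists s; apply: val_inj; exact: lle_anti.
exists (fun x => sval (cid (emb_surj x))) => [s|x]; last by case: cid.
by case: cid => t /= /(congr1 val)/env_emb_inj.
Qed.

End Unit.

Section Counit.
Variables (R : realType) (P : pbal_obj R).

(** Computed on the chosen representative; [counitE] shows that every other one gives the same
    difference. *)
Definition counit_fun (x : envelope (reflexives P)) : P :=
  val (env_num x) - val (env_den x).

Lemma counitE a b : counit_fun (cls a b) = val a - val b.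
Proof.
have /(congr1 val) /= e := env_num_den a b.
rewrite /counit_fun; apply/eqP; rewrite subr_eq addrAC eq_sym subr_eq; apply/eqP.
by rewrite [LHS]addrC -[LHS]e.
Qed.

Lemma counit_emb a : counit_fun (env_emb a) = val a.
Proof. by rewrite counitE subr0. Qed.

(** The envelope compares cross sums, which in the ring [P] amounts to comparing differences.
    Injectivity and [counit_prox] rest on this. *)
Lemma counit_le x y : (counit_fun x ≼ counit_fun y) = (x ≼ y).
Proof.
elim/clsW: x => a b; elim/clsW: y => c d.
rewrite cls_le !counitE -[RHS]/(val a + val d ≼ val b + val c).
rewrite lring_leBr [RHS]lring_leBr; congr (_ ≼ _); ring.
Qed.

Lemma counit_inj : injective counit_fun.
Proof. by move=> x y e; apply: lle_anti; rewrite -counit_le e lle_refl. Qed.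

Fact counit_bal : is_bal_morphism counit_fun.
Proof.
split.
- by elim/clsW=> a b; elim/clsW=> c d; rewrite clsD !counitE /=; ring.
(* The product formula holds for representatives in the positive cone, hence [pclsW] instead of
   [clsW]. *)
- elim/pclsW=> a b; elim/pclsW=> c d; rewrite pclsM !counitE.
  rewrite -[LHS]/(rcone_val a * rcone_val c + rcone_val b * rcone_val d -
    (rcone_val a * rcone_val d + rcone_val b * rcone_val c)).
  by rewrite -![val (val _)]/(rcone_val _); ring.
- by rewrite [LHS]counitE subr0.
(* Only nonnegative reals act on reflexive elements; a negative [r] acts by [- r] after swapping the
   two components. *)
- move=> r; elim/clsW=> a b; case: (leP 0 r) => r0.
    rewrite -[r • _ in LHS]/(env_scale r _) env_scaleE // !counitE.
    by rewrite !val_reflexives_ract // rscaleB.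
  rewrite -[r • _ in LHS]/(env_scale r _) env_scaleN // !counitE.
  by rewrite !val_reflexives_ract ?oppr_ge0 1?ltW // !rscaleNl rscaleB opprK addrC.
- elim/clsW=> a b; elim/clsW=> c d.
  rewrite -[_ ⊓ _ in LHS]/(env_meet _ _) env_meetE !counitE.
  rewrite -[LHS]/((val a + val d) ⊓ (val b + val c) - (val b + val d)).
  by rewrite lring_meetDl; congr (_ ⊓ _); ring.
- elim/clsW=> a b; elim/clsW=> c d.
  rewrite -[_ ⊔ _ in LHS]/(env_join _ _) env_joinE !counitE.
  rewrite -[LHS]/(((val a + val d) ⊔ (val b + val c)) - (val b + val d)).
  by rewrite lring_joinDl; congr (_ ⊔ _); ring.
Qed.

Lemma counit_prox (x y : B_obj (reflexives P)) :
  counit_fun x ≺ counit_fun y <-> x ≺ y.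
Proof.
split=> [/(prox_interp (proxP P)) [c [xc cc cy]]|[s]].
  exists (mk_reflexive cc); rewrite -!counit_le counit_emb.
  by split; exact: prox_le (proxP P) _ _ _.
rewrite -!counit_le counit_emb => -[xs sy].
exact: prox_trans (proxP P) _ _ _ _ xs (reflexivesP s) sy.
Qed.

Definition adj_counit : pbal_hom (B_obj (reflexives P)) P :=
  @PbalHom R (B_obj (reflexives P)) P counit_fun counit_bal
    (fun x y => (counit_prox x y).2).

Lemma adj_counit_iso : skeletal P ->
  is_iso (adj_counit : @cat_hom (pbal R) (B_obj (reflexives P)) P).
Proof.
move=> skP; apply: pbal_bij_iso => [|x y]; last exact: (counit_prox x y).1.
have surj (a : P) : exists x, counit_fun x = a.
  have [c [d [cc dd ->]]] := skP a.
  by exists (cls (mk_reflexive cc) (mk_reflexive dd)); rewrite counitE.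
exists (fun a => sval (cid (surj a))) => [x|a]; last by case: cid.
by case: cid => y /= /counit_inj.
Qed.

End Counit.

Section Adjunction.
Variable R : realType.

(** Transposition sends [f] to [R_map f] after the unit; its inverse sends [g] to the counit after
    [B_map g]. *)
Lemma B_left_adjoint_R : left_adjoint (functor_B R) (functor_R R).
Proof.
exists (fun S P f => sbal_comp (R_map f) (adj_unit S)); split.
- move=> S P; exists (fun g : sbal_hom S (reflexives P) =>
    pbal_comp (adj_counit P) (B_map g)) => [f|g].
    have fD := bal_morphD (pbal_fun_bal f).
    apply: pbal_hom_eq; elim/clsW=> a b; rewrite /= env_mapE counitE /=.
    (* Additivity of [f] reduces the claim to [a, 0] = [a, b] + [b, 0]. *)
    by apply/eqP; rewrite subr_eq -fD; apply/eqP; congr (f _);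
      rewrite /env_emb clsD addr0; apply/clsP; rewrite add0r.
  apply: sbal_hom_eq => s; apply: val_inj.
  by rewrite /= env_mapE counitE sbal_hom0 subr0.
- by move=> S P Q g f; apply: sbal_hom_eq => s; exact: val_inj.
- move=> S T P h f; apply: sbal_hom_eq => s; apply: val_inj.
  by rewrite /= env_mapE sbal_hom0.
Qed.

Lemma B_obj_skeletal (S : sbal R) : skeletal (functor_B R S).
Proof.
elim/clsW=> a b; exists (env_emb a), (env_emb b).
split; [exact: env_emb_prox|exact: env_emb_prox|].
by apply: esym; rewrite -[- env_emb b]/(env_opp _) env_oppE clsD addr0 add0r.
Qed.

End Adjunction.

Theorem theorem4p13 (R : realType) :
  left_adjoint (functor_B R) (functor_R R) /\
  exists B_skeletal : forall S : sbal R, skeletal (functor_B R S),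
    cat_equivalence (corestrict B_skeletal)
      (functor_comp (functor_R R) (spbal_inclusion R)).
Proof.
split; first exact: B_left_adjoint_R.
exists (@B_obj_skeletal R); split.
- exists (fun S => adj_unit S); split=> [S T f|S]; last first.
    exact: sbal_bij_iso (@adj_unit_bij R S).
  apply: sbal_hom_eq => s; apply: val_inj.
  by rewrite /= env_mapE sbal_hom0.
- exists (fun P => adj_counit (sval P)); split=> [P Q f|P]; last first.
    exact: adj_counit_iso (svalP P).
  apply: pbal_hom_eq; elim/clsW=> a b.
  rewrite /= env_mapE !counitE /=.
  (* Naturality of the counit is f(a - b) = f(a) - f(b), which follows from preservation of sums. *)
  have fD := bal_morphD (pbal_fun_bal f).
  by apply/eqP; rewrite eq_sym subr_eq -fD subrK.
Qed.
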